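(* Let $f=4/5$, $d_1=3/5$, $d_3=1/10$, $d_1^1+d_3^1=15/100$, $\delta^1=1/200$, $\delta^2=\sqrt2/200$, and let $\pi\colon\mathbb{R}\to\mathbb{R}$ be the piecewise linear function given by these parameters and the two-step construction described in the context. Then $\pi$ is extreme for $R_f(\mathbb{R},\mathbb{Z})$.
   Context: Group problem. $R_f(\mathbb{R},\mathbb{Z})$ is the convex hull of the set of all functions $s\colon\mathbb{R}\to\mathbb{Z}_+$ of finite support with $\sum_{r} r\,s(r)\in f+\mathbb{Z}$. A valid function is a function $\pi\colon\mathbb{R}\to\mathbb{R}$ with $\pi\ge0$ and $\sum_r\pi(r)s(r)\ge1$ for all $s\in R_f(\mathbb{R},\mathbb{Z})$. A valid function $\pi$ is extreme if $\pi=\frac12(\pi^1+\pi^2)$ with $\pi^1,\pi^2$ valid implies $\pi=\pi^1=\pi^2$. Construction (superscripts are indices; $d^i_j$ is the length of the $i$-th interval on which the slope is $c_j$). Step 1. Given $f\in(0,1)$ and lengths $d_1,d_2,d_3>0$ with $d_1+d_2+d_3=f$, set $c_2=0$, $c_3=-\frac1{1-f}$, $c_1=\frac{1-d_2c_2-d_3c_3}{d_1}$. The positive numbers $d^i_j$ are determined by $d_1^1+d_1^2+d_1^3+d_1^4+d_1^5=d_1$, $d_2^1+d_2^2=d_2$, $d_3^1+d_3^2+d_3^3+d_3^4=d_3$; the symmetry conditions $d_1^1=d_1^5$, $d_1^2=d_1^4$, $d_2^1=d_2^2$, $d_3^1=d_3^4$, $d_3^2=d_3^3$; the conditions $d_1^1+d_3^1=d_2^1+d_1^3$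 and $d_1^1c_1+d_3^1c_3=d_2^1c_2+d_1^3c_1$; and the prescribed value of $d_1^1+d_3^1$. For the parameters in the claim this gives $d_2=\frac1{10}$, $c_1=\frac52$, $c_2=0$, $c_3=-5$, $d_1^1=d_1^5=\frac2{15}$, $d_1^2=d_1^4=\frac7{60}$, $d_1^3=\frac1{10}$, $d_2^1=d_2^2=\frac1{20}$, $d_3^1=d_3^4=\frac1{60}$, $d_3^2=d_3^3=\frac1{30}$. Step 2. Given $\delta^1,\delta^2>0$ with $\delta^1+\delta^2<d_2^1/2$, let $\delta^i_1,\delta^i_3$ ($i=1,2$) be determined by $\delta^i_1+\delta^i_3=\delta^i$ and $c_1\delta^i_1+c_3\delta^i_3=0$. Put $\tilde d_1^2=d_1^2-\delta_1^1-\delta_1^2$, $\tilde d_1^4=d_1^4-\delta_1^1-\delta_1^2$, $\tilde d_3^2=d_3^2-\delta_3^1-\delta_3^2$, $\tilde d_3^3=d_3^3-\delta_3^1-\delta_3^2$, $e_3=1-f$. The function $\pi$ is the continuous function, periodic modulo $\mathbb{Z}$, with $\pi(0)=0$, that is piecewise linear on $[0,1]$ with consecutive intervals (from left to right, starting at $0$) of lengths $$d_1^1,\ d_3^1,\ \delta_1^1,\ \delta_3^1,\ \delta_1^2,\ \delta_3^2,\ \tilde d_1^2,\ \tilde d_3^2,\ d_2^1,\ d_1^3,\ d_2^2,\ \tilde d_3^3,\ \tilde d_1^4,\ \delta_3^2,\ \delta_1^2,\ \delta_3^1,\ \delta_1^1,\ d_3^4,\ d_1^5,\ e_3,$$ the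 slope on each interval being $c_j$, where $j$ is the subscript of the corresponding length. *)

(* Defs.v *)
From HB Require Import structures.
From mathcomp Require Import all_boot all_order all_algebra.
From mathcomp Require Import ring lra.
From mathcomp Require Import all_classical all_reals all_analysis.

Set Implicit Arguments.
Unset Strict Implicit.
Unset Printing Implicit Defensive.

Import Order.TTheory GRing.Theory Num.Theory.

Local Open Scope classical_set_scope.
Local Open Scope ring_scope.

Section GroupProblem.
Context {R : realType}.
Implicit Types (f : R) (s p pi : R -> R).

(* Functions R -> Z_+ are represented as natural-number-valued real functions,
   so that their convex hull is taken in the real vector space of functions. *)
Definition group_solutions f : set (R -> R) :=
  [set s | [/\ forall r, s r \is a Num.nat,
               finite_set [set r | s r != 0] &
               (\sum_(r \in [set: R]) r * s r) - f \is a Num.int]].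

Definition convex_hull (M : lmodType R) (A : set M) : set M :=
  smallest (@convex_set R M) A.

Definition R_f f : set (R -> R) :=
  @convex_hull (R -> R^o) (group_solutions f).

Definition valid_function f pi : Prop :=
  (forall r, 0 <= pi r) /\
  (forall s, R_f f s -> 1 <= \sum_(r \in [set: R]) pi r * s r).

Definition extreme_function f pi : Prop :=
  valid_function f pi /\
  forall p1 p2, valid_function f p1 -> valid_function f p2 ->
    (forall x, pi x = 2^-1 * (p1 x + p2 x)) -> pi = p1 /\ pi = p2.

End GroupProblem.

Section PiecewiseLinear.
Context {R : realType}.
Implicit Types (L : seq (R * R)) (x : R).

(* [L] lists the pairs (length, slope) of consecutive intervals starting at 0;
   the function is 0 at 0. *)
Fixpoint pwl L x : R :=
  match L with
  | [::] => 0
  | (l, c) :: L' => if x <= l then c * x else c * l + pwl L' (x - l)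
  end.

Definition periodic_pwl L x : R := pwl L (x - (Num.floor x)%:~R).

Definition total_length L : R := \sum_(lc <- L) lc.1.
Definition total_rise L : R := \sum_(lc <- L) lc.1 * lc.2.

End PiecewiseLinear.

Section Construction.
Context {R : realType}.

(* Superscripts come last: [d1_3] is d_1^3, [dt3_2] is \tilde d_3^2, and
   [delta3_2] is \delta_3^2. *)
Record lengths := Lengths {
  d1_1 : R; d1_2 : R; d1_3 : R; d1_4 : R; d1_5 : R;
  d2_1 : R; d2_2 : R;
  d3_1 : R; d3_2 : R; d3_3 : R; d3_4 : R }.

Definition slope2 : R := 0.
Definition slope3 (f : R) : R := - (1 - f)^-1.
Definition slope1 (f d1 d2 d3 : R) : R :=
  (1 - d2 * slope2 - d3 * slope3 f) / d1.

(* [v] is the prescribed value of d_1^1 + d_3^1. *)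
Record step1 (f d1 d2 d3 v : R) (D : lengths) : Prop := Step1 {
  f_gt0 : 0 < f;
  f_lt1 : f < 1;
  d1_gt0 : 0 < d1;
  d2_gt0 : 0 < d2;
  d3_gt0 : 0 < d3;
  sum_d : d1 + d2 + d3 = f;
  lengths_gt0 :
    [/\ [/\ 0 < d1_1 D, 0 < d1_2 D, 0 < d1_3 D, 0 < d1_4 D & 0 < d1_5 D],
        0 < d2_1 D /\ 0 < d2_2 D &
        [/\ 0 < d3_1 D, 0 < d3_2 D, 0 < d3_3 D & 0 < d3_4 D]];
  sum_d1 : d1_1 D + d1_2 D + d1_3 D + d1_4 D + d1_5 D = d1;
  sum_d2 : d2_1 D + d2_2 D = d2;
  sum_d3 : d3_1 D + d3_2 D + d3_3 D + d3_4 D = d3;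
  sym_d1 : d1_1 D = d1_5 D /\ d1_2 D = d1_4 D;
  sym_d2 : d2_1 D = d2_2 D;
  sym_d3 : d3_1 D = d3_4 D /\ d3_2 D = d3_3 D;
  same_length : d1_1 D + d3_1 D = d2_1 D + d1_3 D;
  same_rise :
    d1_1 D * slope1 f d1 d2 d3 + d3_1 D * slope3 f =
    d2_1 D * slope2 + d1_3 D * slope1 f d1 d2 d3;
  prescribed : d1_1 D + d3_1 D = v }.

Record split_lengths := SplitLengths {
  delta1_1 : R; delta3_1 : R; delta1_2 : R; delta3_2 : R }.

(* [c1] and [c3] are the slopes; [e1] and [e2] are \delta^1 and \delta^2. *)
Record step2 (c1 c3 e1 e2 : R) (D : lengths) (E : split_lengths) : Prop :=
  Step2 {
  e1_gt0 : 0 < e1;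
  e2_gt0 : 0 < e2;
  e_small : e1 + e2 < d2_1 D / 2;
  sum_delta1 : delta1_1 E + delta3_1 E = e1;
  sum_delta2 : delta1_2 E + delta3_2 E = e2;
  flat_delta1 : c1 * delta1_1 E + c3 * delta3_1 E = 0;
  flat_delta2 : c1 * delta1_2 E + c3 * delta3_2 E = 0 }.

Definition dt1_2 (D : lengths) E := d1_2 D - delta1_1 E - delta1_2 E.
Definition dt1_4 (D : lengths) E := d1_4 D - delta1_1 E - delta1_2 E.
Definition dt3_2 (D : lengths) E := d3_2 D - delta3_1 E - delta3_2 E.
Definition dt3_3 (D : lengths) E := d3_3 D - delta3_1 E - delta3_2 E.

Definition pieces (f c1 c2 c3 : R) (D : lengths) (E : split_lengths) :
    seq (R * R) :=
  [:: (d1_1 D, c1);     (d3_1 D, c3);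
      (delta1_1 E, c1); (delta3_1 E, c3);
      (delta1_2 E, c1); (delta3_2 E, c3);
      (dt1_2 D E, c1);  (dt3_2 D E, c3);
      (d2_1 D, c2);     (d1_3 D, c1);     (d2_2 D, c2);
      (dt3_3 D E, c3);  (dt1_4 D E, c1);
      (delta3_2 E, c3); (delta1_2 E, c1);
      (delta3_1 E, c3); (delta1_1 E, c1);
      (d3_4 D, c3);     (d1_5 D, c1);     (1 - f, c3)].

Definition construction (f d1 d2 d3 : R) D E : R -> R :=
  periodic_pwl (pieces f (slope1 f d1 d2 d3) slope2 (slope3 f) D E).

(* When all pieces have nonnegative length, this says that they fill [0,1] and
   that the values at 0 and 1 agree, so that [construction] is continuous. *)
Lemma pieces_close_up f d1 d2 d3 v D E :
  step1 f d1 d2 d3 v D ->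
  let L := pieces f (slope1 f d1 d2 d3) slope2 (slope3 f) D E in
  total_length L = 1 /\ total_rise L = 0.
Proof.
case=> f0 f1 a1 a2 a3 sd _ s1 s2 s3 [t1 t1'] t2 [t3 t3'] _ _ _ L.
rewrite /L /total_length /total_rise /pieces !big_cons !big_nil /=.
rewrite /dt1_2 /dt1_4 /dt3_2 /dt3_3; split; first lra.
have e1 : d1 * slope1 f d1 d2 d3 = 1 - d3 * slope3 f.
  by rewrite /slope1 /slope2; field; lra.
have e3 : (1 - f) * slope3 f = -1 by rewrite /slope3; field; lra.
rewrite e3 /slope2 !mulr0.
have -> : d1_2 D = (d1 - d1_1 D - d1_3 D - d1_5 D) / 2 by lra.
have -> : d1_4 D = (d1 - d1_1 D - d1_3 D - d1_5 D) / 2 by lra.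
have -> : d3_2 D = (d3 - d3_1 D - d3_4 D) / 2 by lra.
have -> : d3_3 D = (d3 - d3_1 D - d3_4 D) / 2 by lra.
transitivity (d1 * slope1 f d1 d2 d3 + d3 * slope3 f - 1); first by field.
by rewrite e1; ring.
Qed.

Lemma step1_values d2 D :
  step1 (4 / 5) (3 / 5) d2 (1 / 10) (15 / 100) D <->
  d2 = 1 / 10 /\
  D = Lengths (2 / 15) (7 / 60) (1 / 10) (7 / 60) (2 / 15)
              (1 / 20) (1 / 20)
              (1 / 60) (1 / 30) (1 / 30) (1 / 60).
Proof.
have c3E : slope3 (4 / 5 : R) = - 5 by rewrite /slope3; field.
have c1E x : slope1 (4 / 5) (3 / 5) x (1 / 10) = 5 / 2 :> R.
  by rewrite /slope1 c3E /slope2; field.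
split.
  case=> _ _ _ _ _ sd _ s1 s2 s3 [t1 t1'] t2 [t3 t3'] m1 m2 m3.
  move: m2; rewrite c1E c3E /slope2.
  move: D s1 s2 s3 t1 t1' t2 t3 t3' m1 m3.
  case=> x1 x2 x3 x4 x5 y1 y2 z1 z2 z3 z4 /=.
  by move=> s1 s2 s3 t1 t1' t2 t3 t3' m1 m3 m2; split; [lra|congr Lengths; lra].
case=> -> ->; split; rewrite /= ?c1E ?c3E /slope2; do ?split; lra.
Qed.

Lemma step2_values D E :
  d2_1 D = 1 / 20 ->
  step2 (5 / 2) (- 5) (1 / 200) (Num.sqrt 2 / 200) D E <->
  E = SplitLengths (1 / 300) (1 / 600) (Num.sqrt 2 / 300) (Num.sqrt 2 / 600).
Proof.
move=> dE.
have s0 : 0 < Num.sqrt 2 :> R by rewrite sqrtr_gt0.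
have s2 : Num.sqrt 2 < 2 :> R.
  by rewrite -[ltRHS]ger0_norm// -sqrtr_sqr ltr_sqrt; lra.
split; first by case: E => x y z t; case=> _ _ _ /= *; congr SplitLengths; lra.
by move=> ->; split; rewrite /= ?dE; lra.
Qed.

End Construction.
Arguments lengths : clear implicits.
Arguments split_lengths : clear implicits.

(* Main.v *)
From Stdlib Require Import ZArith.
Require Import Defs.
From mathcomp Require Import all_boot all_order all_algebra finmap.
From mathcomp Require Import all_classical all_reals all_analysis.
From mathcomp Require Import ring lra zify ssrZ.

Set Implicit Arguments.
Unset Strict Implicit.
Unset Printing Implicit Defensive.

Import Order.TTheory GRing.Theory Num.Theory.

Local Open Scope ring_scope.

(** Write [bhk] for the function of the statement, after Basu, Hildebrand and
    Koeppe, and measure positions in units of 1/600.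

    Validity.  A nonnegative subadditive function that equals 1 on [f + Z] is
    valid, because subadditivity compares the sum defining feasibility with one
    value of the function ([valid_functionP]).  Since [bhk] is piecewise
    affine, [bhk x + bhk y - bhk (x + y)] is smallest at a vertex of the
    arrangement of lines on which [x], [y] or [x + y] is a breakpoint, and the
    symmetry [bhk x + bhk (f - x) = 1] turns all vertices into pairs of
    breakpoints ([piecewise_affine_subadditive]).  Breakpoints and values have
    coordinates in Z[sqrt 2] after scaling, so the finitely many remaining
    inequalities are decided by exact integer computation.

    Extremality.  Let [bhk] be the average of two valid functions and [p] one
    of them.  Validity on solutions with at most three terms forces [p] to
    be symmetric, subadditive and periodic, and to be additive at every pair
    where [bhk] is.  Additivity around 0, with nonnegativity, makes [p] linear
    with some slope [k] right of 0, and linear left of 0 with slope -5, as its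
    values at [f] and 1 are known; it also transports these slopes to every
    piece of nonzero slope.  The additive relations
    [p 270 = p 180 + p 90] and [p 270 = p 210 + p 60] then give [k = 5/2].

    What remains are the two flat pieces, on which no two-dimensional family of
    additive relations is available.  On [180, 210] the relations at
    90, 93 and [93 + 3 sqrt 2], where [bhk] takes the same value 1/4, say that
    [p] is invariant under the shifts by 3 and [3 + 3 sqrt 2].  Their ratio is
    irrational, so [p] takes the value [p 180] on a dense set, and
    continuity makes it constant ([locally_sqrt2_periodic_const]).  Symmetry
    handles [270, 300]. *)

(** * Valid functions and halves of valid functions *)

Section ValidFunctions.
Context {R : realType}.
Implicit Types (f x y : R) (p q : R -> R) (xs : seq R).

Definition subadditive_fun p := forall x y, p (x + y) <= p x + p y.
Definition int_periodic p := forall x (z : int), p (x + z%:~R) = p x.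
Definition symmetric_about f p := forall x, p x + p (f - x) = 1.

(** A solution of the group problem is a finite multiset of reals, here a list;
    its multiplicity function turns feasibility into a plain finite sum. *)
Lemma fsum_count_mem xs (p : R -> R) :
  \sum_(r \in [set: R]%classic) p r * (count_mem r xs)%:R =
  \sum_(x <- xs) p x.
Proof.
rewrite (fsbigE (undup xs)) ?undup_uniq//; last first.
  move=> r _; rewrite mem_undup => /count_memPn ->; exact: mulr0.
rewrite -[RHS]big_undup_iterop_count; apply: eq_big => [r|r _].
  by rewrite in_setT.
by rewrite mulr_natr; case: (count_mem r xs) => [|n]; rewrite ?mulr0n.
Qed.

Lemma valid_function_seq f p xs :
  valid_function f p -> \sum_(x <- xs) x - f \is a Num.int ->
  1 <= \sum_(x <- xs) p x.
Proof.
move=> [_ vp] xsf; rewrite -fsum_count_mem; apply: vp.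
apply: sub_gen_smallest; split => [r||].
- exact: natr_nat.
- apply: (@sub_finite_set _ _ [set` xs]) => [r /=|].
    by apply: contra_neqT => /count_memPn ->.
  exact: finite_seq.
- by rewrite (fsum_count_mem xs id).
Qed.

(** The sum [\sum_r p r * s r] is affine in [s], so the inequality only needs
    to hold at the generators of the convex hull; there subadditivity bounds
    the sum below by [p (\sum_r r * s r)], which is 1. *)
Lemma valid_functionP f p : (forall x, 0 <= p x) -> p 0 = 0 ->
  subadditive_fun p -> (forall x, x - f \is a Num.int -> p x = 1) ->
  valid_function f p.
Proof.
move=> p_ge0 p0 psub pf; split=> // s.
(* The sum over all reals is linear only among finitely supported functions,
   hence the extra condition in [A]. *)
pose A : set (R -> R^o) := [set s | finite_set [set r | s r != 0]%classic /\
  1 <= \sum_(r \in [set: R]%classic) p r * s r]%classic.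
have sumE (t : R -> R) (D : {fset R}) (q : R -> R) :
    ([set r | t r != 0] `<=` [set` D])%classic ->
    \sum_(r \in [set: R]%classic) q r * t r = \sum_(r <- D) q r * t r.
  move=> tD; apply: fsbigTE => r; apply: contraNeq => qt.
  apply: tD => /=; apply: contraNneq qt => ->; by rewrite mulr0.
suff : (R_f f `<=` A)%classic by move=> /[apply] -[].
apply: smallest_sub => [s1 s2 k|s'].
  rewrite !in_setE => -[fs1 s1_ge1] [fs2 s2_ge1].
  have fs : finite_set ([set r | s1 r != 0] `|` [set r | s2 r != 0])%classic.
    by rewrite finite_setU.
  have kE r : (conv k s1 s2 : R -> R) r = k%:num * s1 r + (1 - k%:num) * s2 r.
    by [].
  have sub : ([set r | (conv k s1 s2 : R -> R) r != 0%R] `<=`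
      [set r | s1 r != 0%R] `|` [set r | s2 r != 0%R])%classic.
    move=> r /=; rewrite kE; have [->|] := eqVneq (s1 r) 0; last by left.
    by have [->|] := eqVneq (s2 r) 0; [rewrite !mulr0 addr0 eqxx|right].
  have fsk := sub_finite_set sub fs.
  split=> //.
  move: s1_ge1 s2_ge1.
  pose D := fset_set ([set r | s1 r != 0] `|` [set r | s2 r != 0])%classic.
  rewrite !(sumE _ D) ?fset_setK//.
  move=> s1_ge1 s2_ge1.
  under eq_bigr => r _ do rewrite kE mulrDr !(mulrCA (p r)).
  rewrite big_split/= -!mulr_sumr.
  have k0 : 0 <= k%:num by [].
  have k1 : k%:num <= 1 by [].
  nra.
move=> [s_nat fs s_f]; split => //.
pose D := fset_set [set r | s' r != 0]%classic.
rewrite (sumE _ D) ?fset_setK// -(pf _ s_f) (sumE _ D) ?fset_setK//.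
apply: (big_ind2 (fun x y => p x <= y)) => [|x1 y1 x2 y2 le1 le2|r _].
- by rewrite p0.
- exact: le_trans (psub _ _) (lerD le1 le2).
- have /natrP[n ->] := s_nat r.
  rewrite !mulr_natr; elim: n => [|n IHn]; first by rewrite !mulr0n p0.
  by rewrite !mulrS; apply: le_trans (psub _ _) _; rewrite lerD2l.
Qed.

End ValidFunctions.

Section Halves.
Context {R : realType}.
Implicit Types (f x y : R) (p q : R -> R).

(** Validity at the one-term solution [f - z] gives [1 <= p (f - z)], so
    [p z <= 0] by symmetry. *)
Lemma valid_symmetric_int f p (z : int) :
  valid_function f p -> symmetric_about f p -> p z%:~R = 0.
Proof.
move=> vp symp; have [p_ge0 _] := vp.
have := @valid_function_seq _ f p [:: f - z%:~R] vp.
rewrite !big_seq1 addrAC subrr add0r rpredN intr_int => /(_ isT).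
by have := symp z%:~R; have := p_ge0 z%:~R; lra.
Qed.

(** The multiset [x, y, f - (x + y)] is a solution, and symmetry rewrites the
    last term as [1 - p (x + y)]. *)
Lemma valid_symmetric_subadditive f p :
  valid_function f p -> symmetric_about f p -> subadditive_fun p.
Proof.
move=> vp symp x y.
have := @valid_function_seq _ f p [:: x; y; f - (x + y)] vp.
rewrite !big_cons !big_nil !addr0.
have -> : x + (y + (f - (x + y))) - f = 0 by ring.
by move=> /(_ (rpred0 _)); have := symp (x + y); lra.
Qed.

Lemma valid_symmetric_periodic f p :
  valid_function f p -> symmetric_about f p -> int_periodic p.
Proof.
move=> vp symp x z; have psub := valid_symmetric_subadditive vp symp.
have p0 := valid_symmetric_int _ vp symp.
have := psub (x + z%:~R) (- z)%:~R; have := psub x z%:~R.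
rewrite !p0 rmorphN addrK; lra.
Qed.

(** Both halves satisfy [1 <= p x + p (f - x)], and these inequalities average
    to an equality. *)
Lemma half_symmetric f p p1 p2 :
  valid_function f p1 -> valid_function f p2 ->
  (forall x, p x = 2^-1 * (p1 x + p2 x)) ->
  symmetric_about f p -> symmetric_about f p1.
Proof.
move=> v1 v2 pE symp x; have := symp x; rewrite !pE.
have := @valid_function_seq _ f p1 [:: x; f - x] v1.
have := @valid_function_seq _ f p2 [:: x; f - x] v2.
rewrite !big_cons !big_nil !addr0.
have -> : x + (f - x) - f = 0 by ring.
by move=> /(_ (rpred0 _)) + /(_ (rpred0 _)); lra.
Qed.

Lemma half_additive p p1 p2 x y :
  subadditive_fun p1 -> subadditive_fun p2 ->
  (forall x, p x = 2^-1 * (p1 x + p2 x)) ->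
  p (x + y) = p x + p y -> p1 (x + y) = p1 x + p1 y.
Proof.
by move=> s1 s2 pE; rewrite !pE; have := s1 x y; have := s2 x y; lra.
Qed.

End Halves.

(** * Additive functions near 0 *)

Section Cauchy.
Context {R : realType}.

(** Nonnegativity makes [p] monotone, which is what excludes the pathological
    solutions of Cauchy's equation: between consecutive multiples of
    [T / n] the function stays within [p T / n] of the linear one. *)
Lemma nonneg_additive_linear (p : R -> R) (T : R) :
  0 < T ->
  (forall x, 0 <= x <= T -> 0 <= p x) ->
  (forall x y, 0 <= x -> 0 <= y -> x + y <= T -> p (x + y) = p x + p y) ->
  forall x, 0 <= x <= T -> p x = p T / T * x.
Proof.
move=> T0 p_ge0 padd x /andP[x0].
rewrite le_eqVlt => /orP[/eqP ->|xT]; first by field; lra.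
have pmono a b : 0 <= a -> a <= b -> b <= T -> p a <= p b.
  move=> a0 ab bT; have -> : b = a + (b - a) by ring.
  by rewrite padd; [rewrite lerDl; apply: p_ge0|..]; lra.
have pmul n u : 0 <= u -> n%:R * u <= T -> p (n%:R * u) = n%:R * p u.
  move=> u0; elim: n => [|n IHn].
    have := padd 0 0 (lexx _) (lexx _); rewrite !mul0r addr0 => + _.
    by move=> /(_ (ltW T0)); lra.
  rewrite -natr1 !mulrDl !mul1r => nT.
  have nu0 : 0 <= n%:R * u by apply: mulr_ge0.
  by rewrite padd ?IHn//; lra.
have pT0 : 0 <= p T by apply: p_ge0; lra.
have close n : `|p x - p T / T * x| * n.+1%:R <= p T.
  pose u := T / n.+1%:R; pose k := Num.truncn (x / u).
  have u0 : 0 < u by rewrite divr_gt0.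
  have Tu : T = n.+1%:R * u by rewrite /u mulrC divfK.
  clearbody u.
  have /andP[kx xk] : k%:R <= x / u < k.+1%:R.
    by apply: truncn_itv; rewrite divr_ge0// ltW.
  rewrite ler_pdivlMr// in kx; rewrite ltr_pdivrMr// in xk.
  have kn : (k < n.+1)%N.
    rewrite -(ltr_nat R) -(ltr_pM2r u0) -Tu; exact: le_lt_trans xT.
  have kT : k.+1%:R * u <= T by rewrite Tu ler_pM2r// ler_nat.
  have ku0 : 0 <= k%:R * u by rewrite mulr_ge0// ltW.
  have le1 : k%:R * p u <= p x.
    by rewrite -pmul; [apply: pmono => //; lra|lra|lra].
  have le2 : p x <= k.+1%:R * p u.
    by rewrite -pmul; [apply: pmono => //; lra|lra|lra].
  have pTE : p T = n.+1%:R * p u.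
    by have := pmul n.+1 u (ltW u0); rewrite -Tu; apply.
  have -> : p T / T * x = p u * (x / u).
    by rewrite pTE Tu; field; rewrite gt_eqF//= addrC natr1 pnatr_eq0.
  have pu0 : 0 <= p u.
    by apply: p_ge0; move: kT; rewrite -natr1 mulrDl mul1r; lra.
  rewrite pTE mulrC ler_pM2l ?ltr0n// ler_norml.
  have le3 : k%:R * p u <= p u * (x / u).
    by rewrite mulrC ler_wpM2l// ler_pdivlMr.
  have le4 : p u * (x / u) <= k.+1%:R * p u.
    by rewrite [leRHS]mulrC ler_wpM2l// ler_pdivrMr// ltW.
  by move: le2 le4; rewrite -natr1 mulrDl mul1r; lra.
apply/eqP; rewrite -subr_eq0 -normr_le0 leNgt; apply/negP => d0.
pose n := Num.truncn (p T / `|p x - p T / T * x|).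
have := close n; rewrite mulrC -ler_pdivlMr// leNgt => /negP; apply.
exact: truncnS_gt.
Qed.

End Cauchy.

(** * Functions with the two periods 1 and sqrt 2 *)

Section Density.
Context {R : realType}.
Implicit Types (t e : R) (v : R -> R).
Notation sqrt2 := (Num.sqrt 2 : R).

Lemma sqrt2_gt0 : 0 < sqrt2. Proof. by rewrite sqrtr_gt0. Qed.

Lemma sqr_sqrt2 : sqrt2 * sqrt2 = 2.
Proof. by rewrite -expr2 sqr_sqrtr. Qed.

Lemma sqrt2_bounds : 7 / 5 < sqrt2 < 3 / 2.
Proof.
by have := sqr_sqrt2; have := sqrt2_gt0; nra.
Qed.

Lemma period_natmul v e : (forall t, v (t + e) = v t) ->
  forall (n : nat) t, v (t + n%:R * e) = v t.
Proof.
move=> ve; elim=> [|n IHn] t; first by rewrite mul0r addr0.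
by rewrite -natr1 mulrDl mul1r addrA ve.
Qed.

(** With [e = sqrt 2 - 1] the recurrence [e ^ (n+2) + 2 e ^ (n+1) = e ^ n]
    propagates periods from two consecutive powers to the next one. *)
Lemma period_sqrt2_pow v :
  (forall t, v (t + 1) = v t) -> (forall t, v (t + sqrt2) = v t) ->
  forall n t, v (t + (sqrt2 - 1) ^+ n) = v t.
Proof.
move=> v1 vs n; pose per e := forall t, v (t + e) = v t.
suff [] : per ((sqrt2 - 1) ^+ n) /\ per ((sqrt2 - 1) ^+ n.+1) by [].
elim: n => [|n [IH0 IH1]].
  by split=> t; rewrite ?expr1 ?expr0// -(v1 (t + _)) -addrA subrK.
split=> // t.
have <- : v (t + (sqrt2 - 1) ^+ n.+2 + (sqrt2 - 1) ^+ n.+1 +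
               (sqrt2 - 1) ^+ n.+1) = v (t + (sqrt2 - 1) ^+ n.+2).
  by rewrite !IH1.
have -> : t + (sqrt2 - 1) ^+ n.+2 + (sqrt2 - 1) ^+ n.+1 + (sqrt2 - 1) ^+ n.+1 =
    t + (sqrt2 - 1) ^+ n.
  rewrite !exprS -!addrA; congr (_ + _).
  transitivity ((sqrt2 * sqrt2 - 1) * (sqrt2 - 1) ^+ n); first by ring.
  by rewrite sqr_sqrt2; ring.
exact: IH0.
Qed.

(** The powers of [sqrt 2 - 1] are arbitrarily small periods, and the multiples
    of a period smaller than [e] come within [e] below [t]. *)
Lemma sqrt2_periods_dense v e t :
  (forall t, v (t + 1) = v t) -> (forall t, v (t + sqrt2) = v t) ->
  0 < e -> 0 <= t -> exists2 t', 0 <= t' <= t & t - t' < e /\ v t' = v 0.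
Proof.
move=> v1 vs e0 t0.
(* Since [sqrt 2 - 1 < 1 / 2], its n-th power is at most [1 / (n + 1)]. *)
have [n ne] : exists n, (sqrt2 - 1) ^+ n < e.
  have h := sqrt2_bounds; pose n := Num.truncn e^-1; exists n.
  have n0 : 0 < (n.+1%:R : R) by rewrite ltr0n.
  apply: (@le_lt_trans _ _ (n.+1%:R^-1)); last first.
    by rewrite invf_plt ?posrE//; exact: truncnS_gt.
  rewrite -[leRHS]mul1r ler_pdivlMr//; elim: (n) => [|m IHm].
    by rewrite expr0; lra.
  rewrite exprS -natr1; have : 0 <= (sqrt2 - 1) ^+ m by apply: exprn_ge0; lra.
  have : (1 : R) <= m.+1%:R by rewrite ler1n.
  nra.
have h := sqrt2_bounds; set d := (sqrt2 - 1) ^+ n in ne.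
have d0 : 0 < d by apply: exprn_gt0; lra.
have /andP[kt tk] :
    (Num.truncn (t / d))%:R <= t / d < (Num.truncn (t / d)).+1%:R.
  by apply: truncn_itv; rewrite divr_ge0// ltW.
rewrite ler_pdivlMr// in kt; rewrite ltr_pdivrMr// -natr1 mulrDl mul1r in tk.
exists ((Num.truncn (t / d))%:R * d).
  by rewrite kt andbT mulr_ge0// ltW.
split; first by lra.
rewrite -[X in v X]add0r; apply: period_natmul; exact: period_sqrt2_pow.
Qed.

(** The periods are only available inside an interval; its length 10 leaves room
    for shifting [[0, 1)] by [1 + sqrt 2] without leaving it, so extending the
    restriction to [[0, 1)] with period 1 gives a function on the whole line
    that has [sqrt 2] as a second period. *)
Lemma locally_sqrt2_periodic_const v (K d : R) :
  0 < d ->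
  (forall x y, 0 <= x -> x <= y -> y <= 10 -> y - x < d ->
    `|v y - v x| <= K * (y - x)) ->
  (forall t, 0 <= t <= 9 -> v (t + 1) = v t) ->
  (forall t, 0 <= t <= 9 - sqrt2 -> v (t + (1 + sqrt2)) = v t) ->
  forall t, 0 <= t <= 10 -> v t = v 0.
Proof.
move=> d0 vlip v1 vs; have hs := sqrt2_bounds.
have vn (n : nat) t : 0 <= t -> t + n%:R <= 10 -> v (t + n%:R) = v t.
  elim: n t => [|n IHn] t t_ge0; first by rewrite addr0.
  have n_ge0 : 0 <= n%:R :> R by [].
  rewrite -natr1 addrA => tn; rewrite v1; [apply: IHn => //|]; lra.
pose fr t : R := t - (Num.floor t)%:~R.
have frP t : 0 <= fr t < 1.
  have /andP[a b] := floor_itv t; rewrite intrD in b.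
  by rewrite /fr; lra.
have frD1 t : fr (t + 1) = fr t.
  by rewrite /fr floorDrz ?rpred1// intrD floor1; ring.
have vfr t : 0 <= t <= 10 -> v (fr t) = v t.
  move=> t10; have ft : 0 <= Num.floor t by rewrite floor_ge0; lra.
  have E : t = fr t + (`|Num.floor t|%N)%:R.
    by rewrite natr_absz ger0_norm// /fr subrK.
  have := frP t; rewrite [in RHS]E => ?; rewrite vn//; [lra|rewrite -E; lra].
move=> t t10; rewrite -vfr//; set t0 := fr t.
have V1 u : v (fr (u + 1)) = v (fr u) by rewrite frD1.
have frr u : fr (fr u + sqrt2) = fr (u + sqrt2).
  rewrite /fr [u - _ + _]addrAC floorDrz ?rpredN ?intr_int// intrD
    [(Num.floor (- _))%:~R]floorK ?rpredN ?intr_int//.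
  by ring.
have Vs u : v (fr (u + sqrt2)) = v (fr u).
  rewrite -frr vfr; last by have := frP u; lra.
  move: (fr u) (frP u) => a a01.
  by rewrite -v1 -?addrA 1?[sqrt2 + 1]addrC ?vs//; lra.
have fr_id u : 0 <= u < 1 -> fr u = u.
  by move=> u1; rewrite /fr (@floor_def _ _ 0) ?subr0//; lra.
have := frP t; rewrite -/t0 => t01.
apply/eqP; rewrite -subr_eq0 -normr_le0 leNgt; apply/negP => N0.
pose K1 := `|K| + 1; have K10 : 0 < K1 by rewrite ltr_pwDr.
pose e := Num.min d (`|v t0 - v 0| / K1).
have e0 : 0 < e by rewrite lt_min d0 divr_gt0.
have [|t' t't [te]] := @sqrt2_periods_dense (v \o fr) e t0 V1 Vs e0; first lra.
rewrite /= !fr_id; [|lra|lra] => vt'.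
move: te; rewrite lt_min => /andP[td].
rewrite ltr_pdivlMr// -vt' => tN.
have := vlip t' t0; rewrite vt' => /(_ _ _ _ td) H.
have {}H : `|v t0 - v 0| <= K * (t0 - t') by apply: H; lra.
have KK : K * (t0 - t') <= `|K| * (t0 - t').
  by rewrite ler_wpM2r ?ler_norm//; lra.
move: tN; rewrite vt' mulrDr mulr1 mulrC; lra.
Qed.

End Density.

(** * Piecewise affine functions and their vertices *)

Section PiecewiseAffine.
Context {R : realType}.
Implicit Types (B : set R) (g h : R -> R) (f x y : R).
Local Open Scope classical_set_scope.

Definition piecewise_affine B g := forall x, exists a b c,
  [/\ B a, B b, a <= x <= b & forall y, a <= y <= b -> g y = g a + c * (y - a)].

(** An affine function on a segment is at least the smaller of its two end
    values. *)
Lemma piecewise_affine_ge0 B g : piecewise_affine B g ->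
  (forall b, B b -> 0 <= g b) -> forall x, 0 <= g x.
Proof.
move=> gB g_ge0 x.
have [a [b [c [/g_ge0 ga /g_ge0 + /andP[ax xb] gE]]]] := gB x.
rewrite (gE b) ?(gE x) ?ax ?xb ?lexx ?(le_trans ax xb)// => gb.
have [c0|c0] := leP 0 c; first by rewrite addr_ge0// mulr_ge0// subr_ge0.
apply: le_trans gb _; rewrite lerD2l ler_nM2l//; lra.
Qed.

Lemma piecewise_affineD B1 B2 g h : piecewise_affine B1 g ->
  piecewise_affine B2 h -> piecewise_affine (B1 `|` B2) (fun x => g x + h x).
Proof.
move=> gB hB x.
have [a1 [b1 [c1 [Ba1 Bb1 /andP[ax1 xb1] gE]]]] := gB x.
have [a2 [b2 [c2 [Ba2 Bb2 /andP[ax2 xb2] hE]]]] := hB x.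
exists (Num.max a1 a2), (Num.min b1 b2), (c1 + c2); split.
- by case: (leP a1 a2) => _; [right|left].
- by case: (leP b1 b2) => _; [left|right].
- by rewrite ge_max le_min ax1 ax2 xb1.
move=> y; rewrite ge_max le_min => /andP[/andP[ay1 ay2] /andP[yb1 yb2]].
rewrite (gE y) ?ay1// (hE y) ?ay2//.
have [a12|/ltW a12] := leP a1 a2.
  by rewrite (gE a2) ?a12 ?(le_trans ax2)//; ring.
by rewrite (hE a1) ?a12 ?(le_trans ax1)//; ring.
Qed.

Lemma piecewise_affine_scale B g (k m : R) : piecewise_affine B g ->
  piecewise_affine B (fun x => k * g x + m).
Proof.
move=> gB x; have [a [b [c [Ba Bb axb gE]]]] := gB x.
by exists a, b, (k * c); split=> // y /gE ->; ring.
Qed.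

Lemma piecewise_affine_shift B g t : piecewise_affine B g ->
  piecewise_affine [set x | B (x + t)] (fun x => g (x + t)).
Proof.
move=> gB x; have [a [b [c [Ba Bb /andP[ax xb] gE]]]] := gB (x + t).
exists (a - t), (b - t), c; rewrite /= !subrK; split=> //; first lra.
by move=> y aby; rewrite gE; [congr (_ + _ * _); ring|lra].
Qed.

Lemma piecewise_affine_reflect B g t : piecewise_affine B g ->
  piecewise_affine [set x | B (t - x)] (fun x => g (t - x)).
Proof.
move=> gB x; have [a [b [c [Ba Bb /andP[ax xb] gE]]]] := gB (t - x).
exists (t - b), (t - a), (- c); rewrite /= !subKr; split=> //; first lra.
by move=> y aby; rewrite (gE (t - y)) ?(gE b); [ring|lra|lra].
Qed.

Lemma piecewise_affine_symmetric B g f : piecewise_affine B g ->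
  (forall b, B b -> B (f - b)) -> (forall b, B b -> g b + g (f - b) = 1) ->
  symmetric_about f g.
Proof.
move=> gB fB g1.
have sumB (k m : R) : piecewise_affine B (fun x => k * (g x + g (f - x)) + m).
  apply: piecewise_affine_scale => x.
  have [a [b [c [Ba Bb axb gE]]]] :=
    piecewise_affineD gB (piecewise_affine_reflect f gB) x.
  have fBE y : (B `|` [set x | B (f - x)]) y -> B y.
    by case=> //= /fB; rewrite subKr.
  by exists a, b, c; split=> //; exact: fBE.
move=> x.
have ge1 := piecewise_affine_ge0 (sumB 1 (-1)) _ x.
have le1 := piecewise_affine_ge0 (sumB (-1) 1) _ x.
have {}ge1 : 0 <= 1 * (g x + g (f - x)) + -1 by apply: ge1 => b /g1 ->; lra.
have {}le1 : 0 <= -1 * (g x + g (f - x)) + 1 by apply: le1 => b /g1 ->; lra.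
lra.
Qed.

(** For fixed [x] the defect [g x + g y - g (x + y)] is piecewise affine in [y],
    so it suffices that [y] or [x + y] is a breakpoint; repeating this in the
    other variable leaves the vertices.  Symmetry exchanges the pair
    [(u, w - u)] with [(u, f - w)] without changing the defect, so the case of
    a breakpoint [x + y] reduces to that of a breakpoint [y]. *)
Lemma piecewise_affine_subadditive B g f : piecewise_affine B g ->
  symmetric_about f g -> (forall b, B b -> B (f - b)) ->
  (forall u v, B u -> B v -> g (u + v) <= g u + g v) -> subadditive_fun g.
Proof.
move=> gB gsym fB gV.
have flip u w : g u + g (w - u) - g w = g u + g (f - w) - g (u + (f - w)).
  have := gsym w; have := gsym (u + (f - w)).
  have -> : f - (u + (f - w)) = w - u by ring.
  lra.
have halfB y : B y -> forall x, 0 <= g x + g y - g (x + y).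
  move=> By x; have /= := piecewise_affineD (piecewise_affine_scale 1 (g y) gB)
     (piecewise_affine_scale (-1) 0 (piecewise_affine_shift y gB)).
  move=> /piecewise_affine_ge0 H.
  suff : 0 <= 1 * g x + g y + (-1 * g (x + y) + 0) by lra.
  apply: H => u [Bu|/= Buy]; first by have := gV u y Bu By; lra.
  have := flip y (u + y); rewrite addrK.
  by have := gV y (f - (u + y)) By (fB _ Buy); lra.
move=> x y; suff : 0 <= g x + g y - g (x + y) by lra.
have /= := piecewise_affineD (piecewise_affine_scale 1 (g x) gB)
   (piecewise_affine_scale (-1) 0 (piecewise_affine_shift x gB)).
move=> /piecewise_affine_ge0 H.
suff : 0 <= 1 * g y + g x + (-1 * g (y + x) + 0) by rewrite [y + x]addrC; lra.
apply: H => u [Bu|/= Bux].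
  by have := halfB u Bu x; rewrite [x + u]addrC; lra.
have := flip x (u + x); rewrite addrK => E.
by have := halfB (f - (u + x)) (fB _ Bux) x; lra.
Qed.

End PiecewiseAffine.

(** * Functions given by lengths and slopes *)

Section PiecewiseLinear.
Context {R : realType}.
Implicit Types (L : seq (R * R)) (x : R).

Fixpoint nodes L : seq R :=
  0 :: if L is (l, _) :: L' then [seq l + b | b <- nodes L'] else [::].

Definition nonneg_lengths L := all (fun lc => 0 <= lc.1) L.

Lemma nonneg_lengths_cons l c L :
  nonneg_lengths ((l, c) :: L) = (0 <= l) && nonneg_lengths L.
Proof. by []. Qed.

Lemma nonneg_lengths_cat L1 L2 :
  nonneg_lengths (L1 ++ L2) = nonneg_lengths L1 && nonneg_lengths L2.
Proof. exact: all_cat. Qed.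

Lemma nodes0 L : 0 \in nodes L.
Proof. by case: L => [|[l c] L]; rewrite inE eqxx. Qed.

Lemma total_length_cons l c L : total_length ((l, c) :: L) = l + total_length L.
Proof. by rewrite /total_length big_cons. Qed.

Lemma total_length_ge0 L : nonneg_lengths L -> 0 <= total_length L.
Proof. by move=> /allP L0; rewrite /total_length big_seq sumr_ge0. Qed.

Lemma pwl_at0 L : nonneg_lengths L -> pwl L 0 = 0.
Proof. by case: L => //= -[l c] L /andP[/= -> _]; rewrite mulr0. Qed.

Lemma pwl_cons_ge l c L x : nonneg_lengths L -> l <= x ->
  pwl ((l, c) :: L) x = c * l + pwl L (x - l).
Proof.
move=> L0 lx /=; case: ifP => // xl.
have -> : x = l by lra.
by rewrite subrr pwl_at0// addr0.
Qed.

Lemma pwl_cat L1 L2 x : nonneg_lengths L1 -> nonneg_lengths L2 -> 0 <= x ->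
  pwl (L1 ++ L2) (total_length L1 + x) = total_rise L1 + pwl L2 x.
Proof.
elim: L1 x => [|[l c] L1 IH] x.
  by rewrite /total_length /total_rise !big_nil !add0r.
rewrite nonneg_lengths_cons => /andP[l0 n1] n2 x0; rewrite cat_cons.
have tx : 0 <= total_length L1 + x by rewrite addr_ge0// total_length_ge0.
rewrite total_length_cons pwl_cons_ge; [|by rewrite nonneg_lengths_cat n1|lra].
rewrite (_ : _ - l = total_length L1 + x); last by ring.
by rewrite IH// /total_rise big_cons /=; ring.
Qed.

Lemma pwl_total L : nonneg_lengths L -> pwl L (total_length L) = total_rise L.
Proof.
move=> L0; have := @pwl_cat L [::] 0 L0 isT (lexx _).
by rewrite cats0 /= !addr0.
Qed.

Lemma pwl_cat_le L1 L2 x : nonneg_lengths L1 -> nonneg_lengths L2 ->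
  0 <= x <= total_length L1 -> pwl (L1 ++ L2) x = pwl L1 x.
Proof.
elim: L1 x => [|[l c] L1 IH] x.
  rewrite /total_length big_nil => _ n2 /andP[x0 x1].
  by rewrite (_ : x = 0) ?pwl_at0//; lra.
rewrite nonneg_lengths_cons => /andP[l0 n1] n2.
rewrite total_length_cons => xl /=; by case: ifPn => // ?; rewrite IH//; lra.
Qed.

Lemma pwl_nth n L y : nonneg_lengths L -> (n < size L)%N ->
  0 <= y <= (nth (0, 0) L n).1 ->
  pwl L (total_length (take n L) + y) =
  total_rise (take n L) + (nth (0, 0) L n).2 * y.
Proof.
move=> L0 nL /andP[y0 yl].
have := L0; rewrite -{1}[L](cat_take_drop n) nonneg_lengths_cat => /andP[n1 n2].
have := pwl_cat n1 n2 y0; rewrite cat_take_drop => ->; congr (_ + _).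
by rewrite (drop_nth (0, 0))//; case: (nth _ _ _) yl => /= l c ->.
Qed.

Lemma pwl_piece L x : nonneg_lengths L -> 0 <= x <= total_length L ->
  exists a b c, [/\ a \in nodes L, b \in nodes L, a <= x <= b,
    0 <= a /\ b <= total_length L &
    forall y, a <= y <= b -> pwl L y = pwl L a + c * (y - a)].
Proof.
elim: L x => [|[l c] L IH] x L0.
  rewrite /total_length big_nil => x0; exists 0, 0, 0; split; rewrite ?inE//.
  by move=> y _; rewrite /= mul0r addr0.
have := L0; rewrite nonneg_lengths_cons => /andP[l0 L'0].
have tL0 := total_length_ge0 L'0.
rewrite total_length_cons => /andP[x0 xL]; have [xl|lx] := leP x l.
  have lL : l \in nodes ((l, c) :: L).
    rewrite /= inE -[X in X \in map _ _]addr0 map_f ?orbT//; exact: nodes0.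
  exists 0, l, c; rewrite x0 xl lerDl; split; rewrite ?nodes0//.
  by move=> y /andP[y0 yl]; rewrite pwl_at0//= yl; ring.
have [|a [b [k [La Lb /andP[ax xb] [a0 bL] E]]]] := IH (x - l) L'0; first lra.
exists (l + a), (l + b), k; split.
- by rewrite /= inE map_f ?orbT.
- by rewrite /= inE map_f ?orbT.
- lra.
- by split; lra.
move=> y /andP[ay yb]; rewrite !pwl_cons_ge//; [|lra|lra].
rewrite (_ : l + a - l = a); last by ring.
by rewrite E; [ring|lra].
Qed.

Definition lattice_nodes L : set R :=
  [set x | exists2 b, b \in nodes L & exists z : int, x = b + z%:~R]%classic.

Section Periodic.
Variable L : seq (R * R).
Hypotheses (L0 : nonneg_lengths L) (L1 : total_length L = 1).
Hypothesis Lr : total_rise L = 0.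

Lemma periodic_pwl_periodic : int_periodic (periodic_pwl L).
Proof.
move=> x z; rewrite /periodic_pwl floorDrz ?intr_int// intrD.
rewrite [(Num.floor z%:~R)%:~R]floorK ?intr_int//; congr pwl; ring.
Qed.

Lemma periodic_pwlE x : 0 <= x <= 1 -> periodic_pwl L x = pwl L x.
Proof.
move=> /andP[x0]; rewrite /periodic_pwl le_eqVlt => /orP[/eqP ->|x1].
  by rewrite floor1 subrr pwl_at0// -[X in pwl L X]L1 pwl_total.
by rewrite (@floor_def _ _ 0) ?subr0//; lra.
Qed.

Lemma periodic_pwl_piecewise_affine :
  piecewise_affine (lattice_nodes L) (periodic_pwl L).
Proof.
move=> x; have /andP[f1] := floor_itv x; rewrite intrD => f2.
set z := Num.floor x in f1 f2.
have [|a [b [c [La Lb /andP[ax xb] [a0 bL] E]]]] := @pwl_piece L (x - z%:~R) L0.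
  by rewrite L1; lra.
have tr y : a + z%:~R <= y <= b + z%:~R ->
    periodic_pwl L y = pwl L (y - z%:~R).
  move=> aby; rewrite -periodic_pwlE; last by rewrite L1 in bL; lra.
  by rewrite -[in LHS](subrK z%:~R y) periodic_pwl_periodic.
exists (a + z%:~R), (b + z%:~R), c; split.
- by exists a => //; exists z.
- by exists b => //; exists z.
- lra.
by move=> y aby; rewrite !tr//; [rewrite E ?addrK; [ring|lra]|lra].
Qed.

End Periodic.
End PiecewiseLinear.

(** * Exact computation in Z[sqrt 2] *)

Delimit Scope Z_scope with BZ.

(** A pair [(a, b)] stands for [a + b sqrt 2].  The functions on lists of pieces
    mirror those on real pieces, in a form that evaluates. *)
Module Zsqrt2.

Definition add (x y : Z * Z) := ((x.1 + y.1)%BZ, (x.2 + y.2)%BZ).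
Definition sub (x y : Z * Z) := ((x.1 - y.1)%BZ, (x.2 - y.2)%BZ).
Definition scale (k : Z) (x : Z * Z) := ((k * x.1)%BZ, (k * x.2)%BZ).

(** When [a] and [b] have opposite signs, the sign of [a + b sqrt 2] is found by
    comparing [a ^ 2] with [2 b ^ 2]. *)
Definition ge0 (x : Z * Z) :=
  let a2 := (x.1 * x.1)%BZ in let b2 := (2 * (x.2 * x.2))%BZ in
  if (0 <=? x.1)%BZ then (0 <=? x.2)%BZ || (b2 <=? a2)%BZ
  else (0 <=? x.2)%BZ && (a2 <=? b2)%BZ.
Definition le x y := ge0 (sub y x).

Fixpoint pwl (L : seq ((Z * Z) * Z)) (x : Z * Z) : Z * Z :=
  match L with
  | [::] => (0%BZ, 0%BZ)
  | (l, c) :: L' =>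
      if le x l then scale c x else add (scale c l) (pwl L' (sub x l))
  end.

Fixpoint nodes (L : seq ((Z * Z) * Z)) : seq (Z * Z) :=
  (0%BZ, 0%BZ) ::
    if L is (l, _) :: L' then [seq add l b | b <- nodes L'] else [::].

Definition length (L : seq ((Z * Z) * Z)) :=
  foldr (fun lc => add lc.1) (0%BZ, 0%BZ) L.
Definition rise (L : seq ((Z * Z) * Z)) :=
  foldr (fun lc => add (scale lc.2 lc.1)) (0%BZ, 0%BZ) L.

End Zsqrt2.

Section Zsqrt2Value.
Context {R : realType}.
Notation sqrt2 := (Num.sqrt 2 : R).
Implicit Types (x y : Z * Z) (L : seq ((Z * Z) * Z)).

Definition zR (a : Z) : R := (int_of_Z a)%:~R.
Definition zsqrt2 x : R := zR x.1 + zR x.2 * sqrt2.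

Lemma zRD a b : zR (a + b)%BZ = zR a + zR b.
Proof. by rewrite /zR -[(a + b)%BZ]/(a + b : Z) rmorphD intrD. Qed.
Lemma zRB a b : zR (a - b)%BZ = zR a - zR b.
Proof. by rewrite /zR -[(a - b)%BZ]/(a - b : Z) rmorphB intrB. Qed.
Lemma zRM a b : zR (a * b)%BZ = zR a * zR b.
Proof. by rewrite /zR -[(a * b)%BZ]/(a * b : Z) rmorphM intrM. Qed.
Lemma zR_ge0 a : (0 <= zR a) = (0 <=? a)%BZ.
Proof. by rewrite /zR ler0z; apply/idP/idP; lia. Qed.
Lemma zR_le a b : (zR a <= zR b) = (a <=? b)%BZ.
Proof. by rewrite /zR ler_int; apply/idP/idP; lia. Qed.

Lemma zR_nat (n : nat) : zR (Z.of_nat n) = n%:R.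
Proof. by rewrite /zR pmulrn; congr (_%:~R); lia. Qed.

Lemma zsqrt2_nat (n : nat) : zsqrt2 (Z.of_nat n, 0%BZ) = n%:R.
Proof.
rewrite -[LHS]/(zR (Z.of_nat n) + zR (Z.of_nat 0) * sqrt2) !zR_nat.
by rewrite mul0r addr0.
Qed.

Lemma zsqrt2D x y : zsqrt2 (Zsqrt2.add x y) = zsqrt2 x + zsqrt2 y.
Proof. by rewrite /zsqrt2 !zRD; ring. Qed.
Lemma zsqrt2B x y : zsqrt2 (Zsqrt2.sub x y) = zsqrt2 x - zsqrt2 y.
Proof. by rewrite /zsqrt2 !zRB; ring. Qed.
Lemma zsqrt2Z k x : zsqrt2 (Zsqrt2.scale k x) = zR k * zsqrt2 x.
Proof. by rewrite /zsqrt2 !zRM; ring. Qed.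

Lemma zsqrt2_ge0 x : (0 <= zsqrt2 x) = Zsqrt2.ge0 x.
Proof.
rewrite /Zsqrt2.ge0 /zsqrt2 -!zR_ge0 -!zR_le !zRM.
have s0 := @sqrt2_gt0 R; have ss := @sqr_sqrt2 R.
have -> : zR 2%BZ = 2 :> R by [].
set A := zR x.1; set B := zR x.2.
have E : 2 * (B * B) = B * sqrt2 * (B * sqrt2) by rewrite mulrACA ss mulrC.
have [A0|A0] := leP 0 A; have [B0|B0] := leP 0 B => /=.
- by rewrite addr_ge0// mulr_ge0// ltW.
- have Bs : 0 <= - (B * sqrt2) by nra.
  rewrite E -[B * sqrt2 * _]mulrNN; apply/idP/idP => H.
    by apply: ler_pM; lra.
  by rewrite leNgt; apply/negP; nra.
- have Bs : 0 <= B * sqrt2 by nra.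
  rewrite E -[A * A]mulrNN; apply/idP/idP => H.
    by apply: ler_pM; lra.
  by rewrite leNgt; apply/negP; nra.
- by apply/negbTE; rewrite -ltNge; nra.
Qed.

Lemma zsqrt2_le x y : (zsqrt2 x <= zsqrt2 y) = Zsqrt2.le x y.
Proof. by rewrite /Zsqrt2.le -zsqrt2_ge0 zsqrt2B subr_ge0. Qed.

(* Lengths are multiples of the unit [u] and slopes are multiples of [k], so
   that values are multiples of [u * k]. *)
Variables u k : R.
Hypothesis u_gt0 : 0 < u.

Definition scaled_pieces L : seq (R * R) :=
  [seq (zsqrt2 lc.1 * u, zR lc.2 * k) | lc <- L].

Lemma pwl_scaled_pieces L x :
  pwl (scaled_pieces L) (zsqrt2 x * u) = zsqrt2 (Zsqrt2.pwl L x) * (u * k).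
Proof.
elim: L x => [|[l c] L IH] x /=; first by rewrite /zsqrt2 /zR/=; ring.
rewrite ler_pM2r// zsqrt2_le; case: ifP => _; first by rewrite zsqrt2Z; ring.
by rewrite -mulrBl -zsqrt2B IH zsqrt2D zsqrt2Z; ring.
Qed.

Lemma nodes_scaled_pieces L :
  nodes (scaled_pieces L) = [seq zsqrt2 b * u | b <- Zsqrt2.nodes L].
Proof.
elim: L => [|[l c] L IH] /=; first by rewrite /zsqrt2 /zR/= !mul0r addr0 mul0r.
rewrite IH -!map_comp /zsqrt2 /zR/= !mul0r addr0 mul0r; congr cons.
apply: eq_map => b /=; rewrite -mulrDl; congr (_ * u).
by rewrite -[RHS]/(zsqrt2 (Zsqrt2.add l b)) zsqrt2D.
Qed.

Lemma total_length_scaled_pieces L :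
  total_length (scaled_pieces L) = zsqrt2 (Zsqrt2.length L) * u.
Proof.
elim: L => [|[l c] L IH].
  by rewrite /total_length big_nil (zsqrt2_nat 0) mul0r.
by rewrite total_length_cons IH zsqrt2D [RHS]mulrDl.
Qed.

Lemma total_rise_scaled_pieces L :
  total_rise (scaled_pieces L) = zsqrt2 (Zsqrt2.rise L) * (u * k).
Proof.
elim: L => [|[l c] L IH].
  by rewrite /total_rise big_nil (zsqrt2_nat 0) mul0r.
rewrite /total_rise big_cons -/(total_rise _) IH zsqrt2D zsqrt2Z [RHS]mulrDl.
by congr (_ + _); rewrite mulrACA [zsqrt2 _ * zR _]mulrC.
Qed.

End Zsqrt2Value.

(** * The function of the theorem *)

(** The unit of length is 1/600 and the unit of slope is [c1 = 5 / 2], so the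
    unit of value is 1/240 and [c3 = - 5] is encoded as -2. *)
Definition bhk_pieces : seq ((Z * Z) * Z) := [::
  ((80, 0), 1); ((10, 0), -2); ((2, 0), 1); ((1, 0), -2);
  ((0, 2), 1); ((0, 1), -2); ((68, -2), 1); ((19, -1), -2);
  ((30, 0), 0); ((60, 0), 1); ((30, 0), 0);
  ((19, -1), -2); ((68, -2), 1); ((0, 1), -2); ((0, 2), 1);
  ((1, 0), -2); ((2, 0), 1); ((10, 0), -2); ((80, 0), 1); ((120, 0), -2)]%BZ.

(** The finite verifications at the breakpoints.  In these units 600 is one
    period, 480 is [f], and 240 is the value 1. *)
Module Bhk.
Import Zsqrt2.
Notation N := (nodes bhk_pieces).
Notation P := (pwl bhk_pieces).

Definition wrap w := if le w (600, 0)%BZ then w else sub w (600, 0)%BZ.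
Definition reflect u :=
  sub (if le u (480, 0)%BZ then (480, 0)%BZ else (1080, 0)%BZ) u.

Lemma lengths_ge0 : all (fun lc => ge0 lc.1) bhk_pieces.
Proof. by vm_compute. Qed.

Lemma node_range u : u \in N -> ge0 u && le u (600, 0)%BZ.
Proof.
have /allP : all (fun u => ge0 u && le u (600, 0)%BZ) N by vm_compute.
exact.
Qed.

Lemma node_ge0 u : u \in N -> ge0 (P u).
Proof.
have /allP : all (fun u => ge0 (P u)) N by vm_compute.
exact.
Qed.

Lemma node_symmetric u : u \in N ->
  reflect u \in N /\ add (P u) (P (reflect u)) = (240, 0)%BZ.
Proof.
have /allP : all (fun u => (reflect u \in N) &&
  (add (P u) (P (reflect u)) == (240, 0)%BZ)) N by vm_compute.
by move=> /[apply] /andP[-> /eqP ->].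
Qed.

Lemma node_subadditive u v : u \in N -> v \in N ->
  le (P (wrap (add u v))) (add (P u) (P v)).
Proof.
have /allP : all (fun u => all (fun v =>
  le (P (wrap (add u v))) (add (P u) (P v))) N) N by vm_compute.
by move=> /[apply] /allP /[apply].
Qed.

End Bhk.

Section BhkFunction.
Context {R : realType}.
Notation sqrt2 := (Num.sqrt 2 : R).
Implicit Types (x y : R).

Definition bhk_pwl : seq (R * R) := scaled_pieces (600^-1) (5 / 2) bhk_pieces.
(** Locked, because comparing two values of this function by unfolding the
    twenty pieces over an abstract field of reals is intractable. *)
Definition bhk : R -> R := locked (periodic_pwl bhk_pwl).

Lemma bhk_unlock : bhk = periodic_pwl bhk_pwl.
Proof. by rewrite /bhk -lock. Qed.

Lemma bhk_lengths : nonneg_lengths bhk_pwl.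
Proof.
rewrite /nonneg_lengths /bhk_pwl all_map.
apply: sub_all Bhk.lengths_ge0 => -[l c] /=.
rewrite -(@zsqrt2_ge0 R) => l0; apply: mulr_ge0 l0 _.
by rewrite invr_ge0 ler0n.
Qed.

Lemma bhk_total_length : total_length bhk_pwl = 1.
Proof.
have -> : 1 = zsqrt2 (Z.of_nat 600, 0%BZ) * 600^-1 :> R.
  by rewrite zsqrt2_nat mulfV ?pnatr_eq0.
by rewrite total_length_scaled_pieces; congr (zsqrt2 _ * _).
Qed.

Lemma bhk_total_rise : total_rise bhk_pwl = 0.
Proof.
rewrite total_rise_scaled_pieces.
by rewrite (_ : Zsqrt2.rise _ = (Z.of_nat 0, 0%BZ)) ?zsqrt2_nat ?mul0r//.
Qed.

Lemma bhk_periodic : int_periodic bhk.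
Proof. by rewrite bhk_unlock; exact: periodic_pwl_periodic. Qed.

Lemma bhkE x : 0 <= x <= 1 -> bhk x = pwl bhk_pwl x.
Proof.
rewrite bhk_unlock.
exact: (periodic_pwlE bhk_lengths bhk_total_length bhk_total_rise).
Qed.

Lemma bhk_zsqrt2 q : Zsqrt2.ge0 q -> Zsqrt2.le q (600, 0)%BZ ->
  bhk (zsqrt2 q / 600) = zsqrt2 (Zsqrt2.pwl bhk_pieces q) / 240.
Proof.
rewrite -!(@zsqrt2_ge0 R) -(@zsqrt2_le R) => q0.
rewrite [zsqrt2 (600%BZ, _)](zsqrt2_nat 600).
move=> q600; rewrite bhkE; last by apply/andP; split; lra.
have u0 : 0 < 600^-1 :> R by rewrite invr_gt0 ltr0n.
by rewrite (pwl_scaled_pieces _ u0); congr (_ * _); lra.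
Qed.

Lemma bhk_nodeP b : lattice_nodes bhk_pwl b <->
  exists2 q, q \in Zsqrt2.nodes bhk_pieces &
    exists z : int, b = zsqrt2 q / 600 + z%:~R.
Proof.
rewrite /lattice_nodes /mkset /bhk_pwl nodes_scaled_pieces; split.
  by move=> [_ /mapP[q qN ->] [z ->]]; exists q => //; exists z.
move=> [q qN [z ->]]; exists (zsqrt2 q / 600); last by exists z.
by apply/mapP; exists q.
Qed.

Lemma bhk_node q (z : int) : q \in Zsqrt2.nodes bhk_pieces ->
  bhk (zsqrt2 q / 600 + z%:~R) = zsqrt2 (Zsqrt2.pwl bhk_pieces q) / 240.
Proof.
move=> qN; have /andP[q0 q600] := Bhk.node_range qN.
by rewrite bhk_periodic bhk_zsqrt2.
Qed.

Lemma bhk_node_symmetric b : lattice_nodes bhk_pwl b ->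
  lattice_nodes bhk_pwl (4 / 5 - b) /\ bhk b + bhk (4 / 5 - b) = 1.
Proof.
move=> /bhk_nodeP[q qN [z ->]].
have [] := Bhk.node_symmetric qN; set q' := Bhk.reflect q => q'N Pq.
have [z' ->] : exists z' : int,
    4 / 5 - (zsqrt2 q / 600 + z%:~R) = zsqrt2 q' / 600 + z'%:~R :> R.
  rewrite /q' /Bhk.reflect zsqrt2B; case: ifP => _.
    exists (- z); rewrite [zsqrt2 (480%BZ, _)](zsqrt2_nat 480) rmorphN.
    by field.
  exists (- z - 1); rewrite [zsqrt2 (1080%BZ, _)](zsqrt2_nat 1080).
  by rewrite intrB rmorphN; field.
split; first by apply/bhk_nodeP; exists q' => //; exists z'.
rewrite (bhk_node _ qN) (bhk_node _ q'N) -mulrDl -zsqrt2D Pq.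
by rewrite [zsqrt2 (240%BZ, _)](zsqrt2_nat 240) divff ?pnatr_eq0.
Qed.

Lemma bhk_piecewise_affine : piecewise_affine (lattice_nodes bhk_pwl) bhk.
Proof.
rewrite bhk_unlock.
exact: (periodic_pwl_piecewise_affine bhk_lengths bhk_total_length
          bhk_total_rise).
Qed.

Lemma bhk_symmetric : symmetric_about (4 / 5) bhk.
Proof.
apply: (piecewise_affine_symmetric bhk_piecewise_affine).
  by move=> b /bhk_node_symmetric[].
by move=> b /bhk_node_symmetric[].
Qed.

Lemma bhk_subadditive : subadditive_fun bhk.
Proof.
apply: (piecewise_affine_subadditive bhk_piecewise_affine bhk_symmetric).
  by move=> b /bhk_node_symmetric[].
move=> _ _ /bhk_nodeP[q qN [z ->]] /bhk_nodeP[r rN [z' ->]].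
have := Bhk.node_subadditive qN rN.
rewrite -(@zsqrt2_le R) zsqrt2D (bhk_node _ qN) (bhk_node _ rN) /Bhk.wrap.
have /andP[q0 q600] := Bhk.node_range qN.
have /andP[r0 r600] := Bhk.node_range rN.
move: q0 q600 r0 r600.
rewrite -!(@zsqrt2_ge0 R) -!(@zsqrt2_le R) [zsqrt2 (600%BZ, _)](zsqrt2_nat 600).
move=> q0 q600 r0 r600.
set w := Zsqrt2.add q r; have wE : zsqrt2 w = zsqrt2 q + zsqrt2 r :> R.
  by rewrite zsqrt2D.
have -> : zsqrt2 q / 600 + z%:~R + (zsqrt2 r / 600 + z'%:~R) =
    zsqrt2 w / 600 + (z + z')%:~R :> R by rewrite wE intrD; field.
rewrite bhk_periodic; case: (leP (zsqrt2 w) 600) => w600 qr.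
  rewrite bhk_zsqrt2 -?(@zsqrt2_ge0 R) -?(@zsqrt2_le R)
    ?[zsqrt2 (600%BZ, _)](zsqrt2_nat 600); lra.
set w' := Zsqrt2.sub w _ in qr; have w'E : zsqrt2 w' = zsqrt2 w - 600 :> R.
  by rewrite zsqrt2B [zsqrt2 (600%BZ, _)](zsqrt2_nat 600).
have -> : zsqrt2 w / 600 = zsqrt2 w' / 600 + 1%:~R :> R by rewrite w'E; field.
rewrite bhk_periodic bhk_zsqrt2 -?(@zsqrt2_ge0 R) -?(@zsqrt2_le R)
  ?[zsqrt2 (600%BZ, _)](zsqrt2_nat 600); lra.
Qed.

Lemma bhk_ge0 x : 0 <= bhk x.
Proof.
apply: (piecewise_affine_ge0 bhk_piecewise_affine) => _ /bhk_nodeP[q qN [z ->]].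
rewrite (bhk_node _ qN); apply: divr_ge0; last exact: ler0n.
by rewrite zsqrt2_ge0; exact: Bhk.node_ge0.
Qed.

Lemma bhk_0 : bhk 0 = 0.
Proof. by rewrite bhkE ?lexx ?ler01// pwl_at0//; exact: bhk_lengths. Qed.

Lemma bhk_valid : valid_function (4 / 5) bhk.
Proof.
apply: valid_functionP bhk_ge0 bhk_0 bhk_subadditive _ => x /intrP[z xz].
have -> : x = 4 / 5 + z%:~R by rewrite -xz; ring.
by rewrite bhk_periodic; have := bhk_symmetric 0; rewrite bhk_0 subr0 add0r.
Qed.

(** For the pieces whose end points are rational, given in units of 1/600. *)
Lemma bhk_piece n (a l v : nat) (c : Z) x :
  Zsqrt2.length (take n bhk_pieces) = (Z.of_nat a, 0%BZ) ->
  Zsqrt2.rise (take n bhk_pieces) = (Z.of_nat v, 0%BZ) ->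
  nth ((0, 0), 0)%BZ bhk_pieces n = ((Z.of_nat l, 0%BZ), c) ->
  (n < size bhk_pieces)%N -> (a + l <= 600)%N ->
  a%:R / 600 <= x <= (a + l)%:R / 600 ->
  bhk x = v%:R / 240 + zR c * (5 / 2) * (x - a%:R / 600).
Proof.
move=> aE vE lcE nL al600 /andP[ax xal].
have al1 : (a + l)%:R / 600 <= 1 :> R.
  by rewrite ler_pdivrMr ?ltr0n// mul1r ler_nat.
have a0 : 0 <= a%:R / 600 :> R by apply: divr_ge0; exact: ler0n.
rewrite bhkE; last by rewrite (le_trans a0 ax) (le_trans xal).
have := @pwl_nth R n bhk_pwl (x - a%:R / 600) bhk_lengths.
rewrite size_map (nth_map ((0, 0), 0)%BZ)// lcE -map_take.
rewrite total_length_scaled_pieces total_rise_scaled_pieces aE vE !zsqrt2_nat.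
rewrite [a%:R / 600 + _]addrC subrK => -> //; first by congr (_ + _); field.
by move: xal; rewrite natrD mulrDl subr_ge0 ax /=; lra.
Qed.

End BhkFunction.

Section BhkValues.
Context {R : realType}.
Notation sqrt2 := (Num.sqrt 2 : R).
Notation bhk := (@bhk R).
Implicit Types (x y : R).

Lemma bhk_near0 x : 0 <= x <= 80 / 600 -> bhk x = 5 / 2 * x.
Proof.
move=> x80; have := @bhk_piece R 0 0 80 0 1%BZ x.
rewrite !mul0r add0r subr0 (zR_nat 1) mul1r; exact.
Qed.

Lemma bhk_flat x : 180 / 600 <= x <= 210 / 600 -> bhk x = 3 / 8.
Proof.
move=> x180; rewrite (@bhk_piece R 8 180 30 90 0%BZ x)//.
by rewrite (zR_nat 0) !mul0r addr0; field.
Qed.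

Lemma bhk_middle x : 210 / 600 <= x <= 270 / 600 ->
  bhk x = 3 / 8 + 5 / 2 * (x - 210 / 600).
Proof.
move=> x180; rewrite (@bhk_piece R 9 210 60 90 1%BZ x)//.
by rewrite (zR_nat 1); field.
Qed.

Lemma bhk_last x : 480 / 600 <= x <= 600 / 600 -> bhk x = 5 * (1 - x).
Proof.
move=> x480; rewrite (@bhk_piece R 19 480 120 240 (-2)%BZ x)//.
by rewrite (_ : zR _ = -2)//; field.
Qed.

Lemma bhk_near1 x : 0 <= x <= 120 / 600 -> bhk (- x) = 5 * x.
Proof.
by move=> x120; rewrite -(bhk_periodic _ 1) bhk_last; [rewrite /=; ring|lra].
Qed.

Lemma bhk_flat_symmetric x : 270 / 600 <= x <= 300 / 600 -> bhk x = 5 / 8.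
Proof.
by move=> x270; have := bhk_symmetric x; rewrite [bhk (_ - _)]bhk_flat; lra.
Qed.

(** The splits by [delta^1] and [delta^2] create two further points with the
    value 1/4 of the end of the second piece; their distances to it are the
    periods on the flat pieces. *)
Lemma bhk_quarter :
  [/\ bhk (90 / 600) = 1 / 4, bhk (93 / 600) = 1 / 4 &
      bhk ((93 + 3 * sqrt2) / 600) = 1 / 4].
Proof.
have val q : Zsqrt2.ge0 q && Zsqrt2.le q (600, 0)%BZ &&
    (Zsqrt2.pwl bhk_pieces q == (60, 0)%BZ) -> bhk (zsqrt2 q / 600) = 1 / 4.
  move=> /andP[/andP[q0 q600] /eqP Pq].
  by rewrite (bhk_zsqrt2 q0 q600) Pq [zsqrt2 (60%BZ, _)](zsqrt2_nat 60); field.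
have v3 := val (93, 3)%BZ isT.
split; first by rewrite -(zsqrt2_nat 90); exact: val.
  by rewrite -(zsqrt2_nat 93); exact: val.
by rewrite -v3 /zsqrt2; congr (bhk ((_ + _ * _) / _)).
Qed.

(** * Extremality *)

(** The marked pieces rise with the slope [k] and the others fall with the slope
    -5; the slope stays a parameter because a half of [bhk] has a priori an
    unknown slope on the rising pieces. *)
Definition zigzag (k : R) (M : seq (R * bool)) : seq (R * R) :=
  [seq (m.1, if m.2 then k else - 5) | m <- M].

Definition bhk_start : seq (R * bool) :=
  [seq (zsqrt2 lc.1 * 600^-1, lc.2 == 1%BZ) | lc <- take 8 bhk_pieces].

Lemma zigzag_bhk_start : zigzag (5 / 2) bhk_start = take 8 (@bhk_pwl R).
Proof.
rewrite /zigzag /bhk_start /bhk_pwl /scaled_pieces -map_take -map_comp.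
have /allP ok : all (fun lc => (lc.2 == 1%BZ) || (lc.2 == (-2)%BZ))
    (take 8 bhk_pieces).
  by vm_compute.
apply/eq_in_map => -[l c] /ok /orP[] /eqP /= ->; congr pair.
  by rewrite (zR_nat 1) mul1r.
by rewrite (_ : zR _ = -2)//; field.
Qed.

Lemma take_bhk_pwl n :
  take n (@bhk_pwl R) = scaled_pieces 600^-1 (5 / 2) (take n bhk_pieces).
Proof. by rewrite /scaled_pieces map_take. Qed.

Lemma total_rise_zigzag k (M : seq (R * bool)) : total_rise (zigzag k M) =
  k * (\sum_(m <- M | m.2) m.1) -
  5 * (total_length (zigzag k M) - \sum_(m <- M | m.2) m.1).
Proof.
rewrite /total_rise /total_length /zigzag !big_map /=.
elim: M => [|[l []] M IH]; rewrite ?big_nil ?big_cons /= ?IH; ring.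
Qed.

Lemma bhk_start_lengths :
  all (fun m : R * bool =>
         0 <= m.1 <= if m.2 then 80 / 600 else 120 / 600) bhk_start.
Proof.
rewrite all_map.
have /allP ok : all (fun lc => Zsqrt2.ge0 lc.1 &&
    Zsqrt2.le lc.1 (if lc.2 == 1%BZ then (80, 0)%BZ else (120, 0)%BZ))
    (take 8 bhk_pieces).
  by vm_compute.
apply/allP => -[l c] /ok /= /andP[].
rewrite -(@zsqrt2_ge0 R) -(@zsqrt2_le R) => l0 lc.
rewrite mulr_ge0 ?invr_ge0 ?ler0n//=; move: lc; case: ifP => _.
  by rewrite [zsqrt2 (80%BZ, _)](zsqrt2_nat 80) ler_pM2r ?invr_gt0 ?ltr0n.
by rewrite [zsqrt2 (120%BZ, _)](zsqrt2_nat 120) ler_pM2r ?invr_gt0 ?ltr0n.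
Qed.

Lemma bhk_startE x : 0 <= x <= 180 / 600 ->
  bhk x = pwl (zigzag (5 / 2) bhk_start) x.
Proof.
move=> x180; rewrite bhkE; last by lra.
have := @bhk_lengths R; rewrite -[in X in X -> _](cat_take_drop 8 (@bhk_pwl R)).
rewrite nonneg_lengths_cat => /andP[n1 n2].
rewrite -[in LHS](cat_take_drop 8 (@bhk_pwl R)) zigzag_bhk_start pwl_cat_le//.
rewrite take_bhk_pwl total_length_scaled_pieces.
by rewrite (_ : Zsqrt2.length _ = (Z.of_nat 180, 0%BZ)) ?zsqrt2_nat.
Qed.

Section Half.
Variables p p' : R -> R.
Hypotheses (vp : valid_function (4 / 5) p) (vp' : valid_function (4 / 5) p').
Hypothesis pE : forall x, bhk x = 2^-1 * (p x + p' x).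

Let psym : symmetric_about (4 / 5) p.
Proof. exact: half_symmetric vp vp' pE bhk_symmetric. Qed.

Let p'sym : symmetric_about (4 / 5) p'.
Proof.
by apply: half_symmetric vp' vp _ bhk_symmetric => x; rewrite pE [p x + _]addrC.
Qed.

Let psub : subadditive_fun p.
Proof. exact: valid_symmetric_subadditive vp psym. Qed.

Let pper : int_periodic p. Proof. exact: valid_symmetric_periodic vp psym. Qed.

Let p0 : p 0 = 0. Proof. exact: (valid_symmetric_int 0 vp psym). Qed.

Let padd x y : bhk (x + y) = bhk x + bhk y -> p (x + y) = p x + p y.
Proof.
exact: half_additive psub (valid_symmetric_subadditive vp' p'sym) pE.
Qed.

Let k := p (80 / 600) / (80 / 600).

Lemma half_near0 x : 0 <= x <= 80 / 600 -> p x = k * x.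
Proof.
apply: nonneg_additive_linear; first lra.
  by move=> y _; have [] := vp.
by move=> y z y0 z0 yz; apply: padd; rewrite !bhk_near0; lra.
Qed.

Lemma half_near1 x : 0 <= x <= 120 / 600 -> p (- x) = 5 * x.
Proof.
move=> x120.
have -> : p (- x) = p (- (120 / 600)) / (120 / 600) * x.
  apply: (@nonneg_additive_linear R (fun y => p (- y))) x120; first by lra.
    by move=> y _; have [] := vp.
  move=> y z y0 z0 yz; rewrite opprD; apply: padd.
  by rewrite -opprD !bhk_near1; lra.
rewrite -(pper _ 1) (_ : - (120 / 600) + 1%:~R = 4 / 5).
  2: by rewrite /=; field.
by have := psym 0; rewrite p0 subr0 add0r => ->; field.
Qed.

(** On a rising piece [bhk (a + x) = bhk a + bhk x] and on a falling piece
    [bhk a = bhk (a + x) + bhk (- x)], as long as the piece is no longer than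
    the corresponding piece next to 0; so [p] is affine there with its slope
    next to 0. *)
Lemma half_zigzag M a :
  all (fun m => 0 <= m.1 <= if m.2 then 80 / 600 else 120 / 600) M ->
  (forall x, 0 <= x <= total_length (zigzag (5 / 2) M) ->
     bhk (a + x) = bhk a + pwl (zigzag (5 / 2) M) x) ->
  forall x, 0 <= x <= total_length (zigzag k M) ->
     p (a + x) = p a + pwl (zigzag k M) x.
Proof.
elim: M a => [|[l b] M IH] a.
  rewrite /total_length big_nil => _ _ x /andP[x0 x1] /=.
  by rewrite (_ : x = 0) ?addr0//; lra.
move=> /= /andP[/andP[l0 lb] M_ok].
have nn c : nonneg_lengths (zigzag c M).
  rewrite /nonneg_lengths /zigzag all_map; apply: sub_all M_ok => m /=.
  by case/andP.
have tE c : total_length (zigzag c M) = total_length (zigzag k M).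
  by rewrite /total_length /zigzag !big_map.
rewrite !total_length_cons (tE (5 / 2)) => bhkM.
have t0 := total_length_ge0 (nn k).
have first x : 0 <= x <= l -> p (a + x) = p a + (if b then k else -5) * x.
  move=> /andP[x0 xl].
  have bE : bhk (a + x) = bhk a + (if b then 5 / 2 else -5) * x.
    by rewrite bhkM ?xl//; lra.
  have {lb xl} : x <= if b then 80 / 600 else 120 / 600.
    exact: le_trans xl lb.
  case: b bE {bhkM} => bE xb.
    have x80 : 0 <= x <= 80 / 600 by rewrite x0.
    by rewrite padd ?(half_near0 x80)// bE (bhk_near0 x80).
  have x120 : 0 <= x <= 120 / 600 by rewrite x0.
  have := @padd (a + x) (- x); rewrite addrK bE bhk_near1// half_near1//.
  move=> pa; rewrite pa; ring.
move=> x /andP[x0 xt]; case: leP => [xl|lx]; first by apply: first; lra.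
have -> : a + x = a + l + (x - l) by ring.
rewrite IH//; first by rewrite first ?addrA// l0 lexx.
  move=> y; rewrite tE => /andP[y0 yt]; rewrite -addrA !bhkM; [|lra|lra].
  rewrite lexx; case: leP => [ly|ly]; last by rewrite [l + y]addrC addrK; ring.
  by rewrite (_ : y = 0) ?pwl_at0//; [ring|lra].
by lra.
Qed.

Let start_length c : total_length (zigzag c bhk_start) = 180 / 600.
Proof.
have -> : total_length (zigzag c bhk_start) =
    total_length (zigzag (5 / 2) bhk_start).
  by rewrite /total_length /zigzag !big_map.
rewrite zigzag_bhk_start take_bhk_pwl total_length_scaled_pieces.
by rewrite (_ : Zsqrt2.length _ = (Z.of_nat 180, 0%BZ)) ?zsqrt2_nat.
Qed.

Let bhk_start_shift x : 0 <= x <= total_length (zigzag (5 / 2) bhk_start) ->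
  bhk (0 + x) = bhk 0 + pwl (zigzag (5 / 2) bhk_start) x.
Proof. by rewrite start_length !add0r bhk_0 add0r; exact: bhk_startE. Qed.

Lemma half_180 : p (180 / 600) = k / 4 - 1 / 4.
Proof.
have nn : nonneg_lengths (zigzag k bhk_start).
  rewrite /nonneg_lengths /zigzag all_map.
  apply: sub_all bhk_start_lengths => m /=.
  by case/andP.
have zz := half_zigzag bhk_start_lengths bhk_start_shift.
rewrite -[180 / 600]add0r zz ?start_length; last by lra.
rewrite p0 add0r -(start_length k) (pwl_total nn).
rewrite total_rise_zigzag start_length.
have := total_rise_zigzag (5 / 2) bhk_start.
rewrite start_length zigzag_bhk_start take_bhk_pwl total_rise_scaled_pieces.
rewrite (_ : Zsqrt2.rise _ = (Z.of_nat 90, 0%BZ)) // zsqrt2_nat.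
(* The known rise for the slope 5/2 determines the total rising length [U]. *)
set U := \sum_(m <- _ | _) _ => UE.
have -> : U = 1 / 4 by lra.
by field.
Qed.

Lemma half_90 : p (90 / 600) = 80 / 600 * k - 50 / 600.
Proof.
have [b90 _ _] := bhk_quarter.
have := @padd (90 / 600) (- (10 / 600)).
have -> : 90 / 600 - 10 / 600 = 80 / 600 :> R by field.
rewrite b90 bhk_near1 ?half_near1 ?(@bhk_near0 (80 / 600)); [|lra..].
by rewrite (@half_near0 (80 / 600)); lra.
Qed.

(** The value at 270 is reached through 180 and 90 and also, by symmetry around
    240, through 210; each way gives an affine expression in [k], and they
    agree for a single [k]. *)
Lemma half_slope : k = 5 / 2.
Proof.
have [b90 _ _] := bhk_quarter.
have s210 := psym (210 / 600).
rewrite (_ : 4 / 5 - 210 / 600 = 270 / 600) in s210; last by field.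
have p270 : p (270 / 600) = p (180 / 600) + p (90 / 600).
  rewrite -padd; first by congr p; field.
  rewrite (_ : 180 / 600 + 90 / 600 = 270 / 600); last by field.
  rewrite b90 (@bhk_flat_symmetric (270 / 600)) ?(@bhk_flat (180 / 600)); lra.
have p210 : p (270 / 600) = p (210 / 600) + p (60 / 600).
  rewrite -padd; first by congr p; field.
  rewrite (_ : 210 / 600 + 60 / 600 = 270 / 600); last by field.
  rewrite (@bhk_flat_symmetric (270 / 600)) ?(@bhk_flat (210 / 600)); [|lra..].
  by rewrite bhk_near0; lra.
by move: p270 p210; rewrite half_180 half_90 (@half_near0 (60 / 600)); lra.
Qed.

Lemma half_start x : 0 <= x <= 180 / 600 -> p x = bhk x.
Proof.
move=> x180; have := half_zigzag bhk_start_lengths bhk_start_shift (x := x).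
by rewrite !add0r half_slope start_length p0 add0r -bhk_startE//; apply.
Qed.

Lemma half_local_lipschitz x h :
  0 <= h <= 80 / 600 -> `|p (x + h) - p x| <= 5 * h.
Proof.
move=> h80; have := psub x h; have := psub (x + h) (- h).
rewrite addrK (half_near0 h80) half_slope (@half_near1 h); last by lra.
by rewrite ler_norml; lra.
Qed.

(** Both [y + (90 + a)] and [(y + a) + 90] are additive pairs, because [bhk] is
    constant on each flat piece and takes the same value at 90 and [90 + a]. *)
Lemma half_shift y a : bhk (90 / 600 + a) = 1 / 4 ->
  90 / 600 + a <= 180 / 600 -> 0 <= a -> 180 / 600 <= y -> y + a <= 210 / 600 ->
  p (y + a) = p y.
Proof.
move=> ba a180 a0 y180 ya; have [b90 _ _] := bhk_quarter.
have pa : p (90 / 600 + a) = 1 / 4 by rewrite half_start ?ba//; lra.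
have p90 : p (90 / 600) = 1 / 4 by rewrite half_start ?b90//; lra.
have by_ : bhk y = 3 / 8 by apply: bhk_flat; lra.
have bya : bhk (y + a) = 3 / 8 by apply: bhk_flat; lra.
have bsum : bhk (y + (90 / 600 + a)) = 5 / 8 by apply: bhk_flat_symmetric; lra.
have sumE : y + a + 90 / 600 = y + (90 / 600 + a).
  by rewrite -addrA [a + _]addrC.
have h58 : 5 / 8 = 3 / 8 + 1 / 4 :> R by field.
have := @padd y (90 / 600 + a); rewrite bsum by_ ba => /(_ h58) add1.
have := @padd (y + a) (90 / 600); rewrite sumE bsum bya b90 => /(_ h58).
by rewrite add1 pa p90 => /addIr.
Qed.

Lemma half_flat x : 180 / 600 <= x <= 210 / 600 -> p x = 3 / 8.
Proof.
(* The flat piece, rescaled so that the first shift has length 1. *)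
move=> x180; pose v t := p (180 / 600 + 3 / 600 * t).
have s_bd := @sqrt2_bounds R.
have shift a t : bhk (90 / 600 + 3 / 600 * a) = 1 / 4 -> 0 <= a <= 30 ->
    0 <= t -> t + a <= 10 -> v (t + a) = v t.
  move=> ba a30 t0 ta; rewrite /v mulrDr addrA.
  by apply: half_shift ba _ _ _ _; lra.
have vconst : forall t, 0 <= t <= 10 -> v t = v 0.
  apply: (@locally_sqrt2_periodic_const R v (5 * (3 / 600)) 1); first by lra.
  - move=> y z y0 yz z10 zy.
    have := @half_local_lipschitz (180 / 600 + 3 / 600 * y) (3 / 600 * (z - y)).
    rewrite (_ : _ + 3 / 600 * (z - y) = 180 / 600 + 3 / 600 * z); last by ring.
    by rewrite /v -[5 * _ * _]mulrA; apply; lra.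
  - have [_ b93 _] := bhk_quarter.
    have {}b93 : bhk (90 / 600 + 3 / 600 * 1) = 1 / 4.
      by rewrite -b93; congr (bhk _); field.
    by move=> t t9; apply: shift b93 _ _ _; lra.
  have [_ _ b93s] := bhk_quarter.
  have {}b93s : bhk (90 / 600 + 3 / 600 * (1 + sqrt2)) = 1 / 4.
    by rewrite -b93s; congr (bhk _); field.
  by move=> t t9; apply: shift b93s _ _ _; lra.
have := vconst (200 * x - 60).
rewrite /v (_ : 180 / 600 + 3 / 600 * (200 * x - 60) = x); last by field.
rewrite mulr0 addr0 (@half_start (180 / 600)) ?(@bhk_flat (180 / 600)).
2,3: lra.
by apply; lra.
Qed.

Lemma half_eq : p = bhk.
Proof.
have p270 x : 0 <= x <= 270 / 600 -> p x = bhk x.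
  move=> x270; have [x180|x180] := leP x (180 / 600).
    by rewrite half_start//; lra.
  have [x210|x210] := leP x (210 / 600).
    by rewrite half_flat ?bhk_flat; lra.
  have := @padd (210 / 600) (x - 210 / 600).
  rewrite [210 / 600 + _]addrC subrK (@half_flat (210 / 600)); last by lra.
  rewrite (@bhk_middle x) ?(@bhk_flat (210 / 600)); [|lra..].
  rewrite (@bhk_near0 (x - 210 / 600)) ?(@half_near0 (x - 210 / 600)); [|lra..].
  by rewrite half_slope; apply.
have p480 x : 0 <= x <= 480 / 600 -> p x = bhk x.
  move=> x480; have [x270|x270] := leP x (270 / 600); first by apply: p270; lra.
  have := psym x; have := bhk_symmetric x; rewrite (p270 (4 / 5 - x)); lra.
apply/funext => x.
have /andP[f1 f2] := floor_itv x; rewrite intrD in f2.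
rewrite -(subrK (Num.floor x)%:~R x) pper bhk_periodic.
set y := x - _; have y01 : 0 <= y < 1 by rewrite /y; lra.
have [y480|y480] := leP y (480 / 600); first by apply: p480; lra.
rewrite -(pper _ (-1)) -(bhk_periodic _ (-1)).
have -> : y + (-1)%:~R = - (1 - y) by rewrite rmorphN; ring.
by rewrite half_near1 ?bhk_near1; lra.
Qed.

End Half.

Theorem bhk_extreme : extreme_function (4 / 5) bhk.
Proof.
split=> [|p1 p2 v1 v2 pE]; first exact: bhk_valid.
split; apply: esym; first exact: half_eq v1 v2 pE.
by apply: half_eq v2 v1 _ => x; rewrite pE [p1 x + _]addrC.
Qed.

End BhkValues.

Lemma constructionE (R : realType) d2 (D : lengths R) (E : split_lengths R) :
  step1 (4 / 5) (3 / 5) d2 (1 / 10) (15 / 100) D ->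
  step2 (slope1 (4 / 5) (3 / 5) d2 (1 / 10)) (slope3 (4 / 5))
        (1 / 200) (Num.sqrt 2 / 200) D E ->
  construction (4 / 5) (3 / 5) d2 (1 / 10) D E = @bhk R.
Proof.
have c3E : slope3 (4 / 5 : R) = - 5 by rewrite /slope3; field.
have c1E : slope1 (4 / 5) (3 / 5) d2 (1 / 10) = 5 / 2 :> R.
  by rewrite /slope1 c3E /slope2; field.
move=> /step1_values[_ DE]; rewrite bhk_unlock /construction c1E c3E.
have d2E : d2_1 D = 1 / 20 by rewrite DE.
move=> /(step2_values _ d2E) ->; rewrite {}DE; congr periodic_pwl.
rewrite /pieces /bhk_pwl /scaled_pieces /bhk_pieces /slope2.
rewrite /dt1_2 /dt1_4 /dt3_2 /dt3_3 /= /zsqrt2 /zR /=.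
by do 20 (congr cons; first by congr pair; rewrite /Pos.to_nat/= -?pmulrn; lra).
Qed.

Theorem theorem5p3 (R : realType) (d2 : R) (D : lengths R)
    (E : split_lengths R)
    (hD : step1 (4 / 5) (3 / 5) d2 (1 / 10) (15 / 100) D)
    (hE : step2 (slope1 (4 / 5) (3 / 5) d2 (1 / 10)) (slope3 (4 / 5))
                (1 / 200) (Num.sqrt 2 / 200) D E) :
  extreme_function (4 / 5)
    (construction (4 / 5) (3 / 5) d2 (1 / 10) D E).
Proof. rewrite (constructionE hD hE); exact: bhk_extreme. Qed.
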